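(* Let $\mathcal{H}$ be a real Hilbert space, let $T\colon\mathcal{H}\rightrightarrows\mathcal{H}$ be maximally monotone, let $M\in\mathcal{S}_{++}(\mathcal{H})$, let $Q\in\mathcal{S}_0(\mathcal{H})$ have finite rank $r$, let $\mathrm{s}\in\{-1,1\}$, and suppose $V:=M+\mathrm{s}Q\in\mathcal{S}_{++}(\mathcal{H})$. Let $u_1,\dots,u_r\in\mathrm{im}(Q)$ be any $r$ linearly independent vectors and let $U\colon\mathbb{R}^r\to\mathrm{im}(Q)$, $U\alpha:=\sum_{i=1}^r\alpha_iu_i$, be the corresponding isomorphism. Let $z\in\mathcal{H}$ and define $\ell\colon\mathbb{R}^r\to\mathbb{R}^r$ by $$\ell(\alpha):=U^*Q^{-1}U\alpha+U^*\big(z-J_T^M(z-\mathrm{s}M^{-1}U\alpha)\big).$$ Then for $x^*\in\mathcal{H}$: $$x^*=J_T^V(z)\iff x^*=J_T^M(z-\mathrm{s}M^{-1}U\alpha^* )\ \text{ where }\alpha^*\in\mathbb{R}^r\text{ solves }\ell(\alpha^* )=0 .$$ Moreover, $\ell$ is Lipschitz continuous with constant $\|U^*Q^{-1}U\|+\|M^{-1/2}U\|^2$ and strictly monotone.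
   Context: $\mathcal{S}(\mathcal{H})$ is the set of bounded self-adjoint linear operators on $\mathcal{H}$; $U\succeq V$ means $\langle Ux,x\rangle\ge\langle Vx,x\rangle$ for all $x$; $\mathcal{S}_0(\mathcal{H})=\{U\in\mathcal{S}(\mathcal{H}):U\succeq0\}$; $\mathcal{S}_{++}(\mathcal{H})=\{U\in\mathcal{S}(\mathcal{H}):U\succ0\}$, where $U\succ 0$ means $U\succeq\sigma\,\mathrm{Id}$ for some $\sigma>0$. $Q$ has finite rank $r$ if $r=\dim(\mathrm{im}(Q))$. The resolvent of $T$ in the metric $M$ is $J_T^M=(\mathrm{Id}+M^{-1}T)^{-1}$. $U$ is also regarded as a map into $\mathcal{H}$ and $U^*\colon\mathcal{H}\to\mathbb{R}^r$ is its adjoint. $Q^{-1}$ is the set-valued inverse of $Q$; $U^*Q^{-1}U\alpha$ denotes $U^*w$ for any $w\in\mathcal{H}$ with $Qw=U\alpha$ (the value does not depend on the choice of $w$), so $U^*Q^{-1}U$ is a linear map $\mathbb{R}^r\to\mathbb{R}^r$. Norms of linear maps are operator norms. A map $\ell\colon\mathbb{R}^r\to\mathbb{R}^r$ is strictly monotone if $\langle\ell(\alpha)-\ell(\beta),\alpha-\beta\rangle>0$ for all $\alpha\ne\beta$. *)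

(* Defs.v *)
From HB Require Import structures.
From mathcomp Require Import all_boot all_order all_algebra.
From mathcomp Require Import boolp classical_sets reals topology normedtype.

Set Implicit Arguments.
Unset Strict Implicit.
Unset Printing Implicit Defensive.

Import Order.TTheory GRing.Theory Num.Theory.
Import numFieldNormedType.Exports.

Local Open Scope classical_set_scope.
Local Open Scope ring_scope.

HB.mixin Record CompleteNormedModule_isHilbert (R : realType) H
    & CompleteNormedModule R H := {
  inner : H -> H -> R;
  innerC : forall x y, inner x y = inner y x;
  inner_linearl : forall (a : R) x y z,
    inner (a *: x + y) z = a * inner x z + inner y z;
  (* with the norm axioms this makes [inner] positive definite *)
  sqr_normE : forall x : H, `|x| ^+ 2 = inner x x
}.

#[short(type="hilbertType")]
HB.structure Definition Hilbert (R : realType) :=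
  {H of CompleteNormedModule R H & CompleteNormedModule_isHilbert R H}.

(* The library's norm on ['rV[R]_n] is the max norm, hence the alias, which
   carries the Euclidean norm instead. *)
Definition euclid (R : realType) (n : nat) : Type := 'rV[R]_n.

Section Euclid.
Variables (R : realType) (n : nat).
Implicit Types x y z : 'rV[R]_n.

Definition edot x y : R := \sum_i x 0 i * y 0 i.
Definition enorm x : R := Num.sqrt (edot x x).

Lemma edotC x y : edot x y = edot y x.
Proof. by apply: eq_bigr => i _; rewrite mulrC. Qed.

Lemma edot_linearl (a : R) x y z : edot (a *: x + y) z = a * edot x z + edot y z.
Proof.
rewrite /edot mulr_sumr -big_split; apply: eq_bigr => i _ /=.
by rewrite !mxE mulrDl mulrA.
Qed.

Lemma edot_ge0 x : 0 <= edot x x.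
Proof. by apply: sumr_ge0 => i _; rewrite -expr2 sqr_ge0. Qed.

Lemma edot_eq0 x : edot x x = 0 -> x = 0.
Proof.
move=> /eqP; rewrite psumr_eq0; last by move=> i _; rewrite -expr2 sqr_ge0.
move=> /allP x0; apply/rowP => i; rewrite mxE; apply/eqP.
by have := x0 i (mem_index_enum _); rewrite mulf_eq0 orbb.
Qed.

Lemma sqr_enorm x : enorm x ^+ 2 = edot x x.
Proof. by rewrite sqr_sqrtr ?edot_ge0. Qed.

Lemma edotDD x y : edot (x + y) (x + y) = edot x x + edot x y *+ 2 + edot y y.
Proof.
have dl u v w : edot (u + v) w = edot u w + edot v w.
  by rewrite -[u]scale1r edot_linearl scale1r mul1r.
rewrite dl ![edot _ (x + y)]edotC !dl [edot y x]edotC mulr2n.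
by rewrite !addrA.
Qed.

Lemma edotZZ (a : R) x : edot (a *: x) (a *: x) = a ^+ 2 * edot x x.
Proof.
by rewrite /edot mulr_sumr; apply: eq_bigr => i _; rewrite !mxE mulrACA expr2.
Qed.

Lemma edot_CauchySchwarz x y : edot x y ^+ 2 <= edot x x * edot y y.
Proof.
have [y0|yN0] := eqVneq (edot y y) 0.
  have -> : y = 0 by exact: edot_eq0.
  rewrite /edot big1 ?expr0n/=; last by move=> i _; rewrite mxE mulr0.
  by rewrite [X in _ * X]big1 ?mulr0// => i _; rewrite mxE mulr0.
have y_gt0 : 0 < edot y y by rewrite lt_def yN0 edot_ge0.
have := edot_ge0 (edot y y *: x + (- edot x y) *: y).
have dZ a b : edot (a *: x) (b *: y) = a * b * edot x y.
  by rewrite /edot mulr_sumr; apply: eq_bigr => i _; rewrite !mxE mulrACA.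
rewrite edotDD !edotZZ dZ.
set A := edot x x; set B := edot y y; set C := edot x y.
have -> : B ^+ 2 * A + (B * - C * C) *+ 2 + (- C) ^+ 2 * B
          = B * (A * B - C ^+ 2).
  by rewrite sqrrN mulrN mulNr mulNrn mulr2n opprD mulrBr !expr2 !mulrA
     (mulrC (C * C) B) !mulrA (mulrAC B A B) addrA subrK.
by rewrite pmulr_rge0// subr_ge0.
Qed.

Lemma ler_enormD x y : enorm (x + y) <= enorm x + enorm y.
Proof.
have s0 : 0 <= enorm x + enorm y by rewrite addr_ge0 ?sqrtr_ge0.
rewrite -(ger0_norm s0) -sqrtr_sqr ler_sqrt ?sqr_ge0//.
rewrite edotDD sqrrD !sqr_enorm lerD2r lerD2l lerMn2r/=.
rewrite -sqrtrM ?edot_ge0// (le_trans (ler_norm _))// -sqrtr_sqr.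
by rewrite ler_sqrt ?edot_CauchySchwarz// mulr_ge0 ?edot_ge0.
Qed.

Lemma enormZ (a : R) x : enorm (a *: x) = `|a| * enorm x.
Proof. by rewrite /enorm edotZZ sqrtrM ?sqr_ge0// sqrtr_sqr. Qed.

Lemma enorm_eq0 x : enorm x = 0 -> x = 0.
Proof.
move=> /(congr1 (fun t => t ^+ 2)); rewrite sqr_enorm expr0n/=.
exact: edot_eq0.
Qed.

Lemma coord_enorm x i : `|x 0 i| <= enorm x.
Proof.
rewrite -sqrtr_sqr ler_sqrt ?edot_ge0// /edot (bigD1 i)//= -expr2 lerDl.
by apply: sumr_ge0 => j _; rewrite -expr2 sqr_ge0.
Qed.

Lemma enorm_sum x : enorm x <= \sum_i `|x 0 i|.
Proof.
have s0 : 0 <= \sum_i `|x 0 i| by exact: sumr_ge0.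
rewrite -(ger0_norm s0) -sqrtr_sqr ler_sqrt ?sqr_ge0// expr2 mulr_suml.
apply: ler_sum => i _; rewrite -[_ * _]ger0_norm -?expr2 ?sqr_ge0//.
rewrite normrX expr2 ler_wpM2l// (bigD1 i)//= lerDl.
exact: sumr_ge0.
Qed.

HB.instance Definition _ := GRing.Lmodule.copy (euclid R n) 'rV[R]_n.
HB.instance Definition _ :=
  @Lmodule_isNormed.Build R (euclid R n) enorm ler_enormD enormZ enorm_eq0.

Lemma euclid_complete (F : set_system (euclid R n)) :
  ProperFilter F -> cauchy F -> cvg F.
Proof.
move=> FF /cauchy_ballP Fc.
have Fcoord i : cvg ((fun x : euclid R n => x 0 i) @ F).
  apply: R_complete; apply/cauchy_ballP => e e0.
  have := Fc e e0; rewrite -ball_normE/= => -[[A B] [FA FB] AB].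
  exists ((fun x : euclid R n => x 0 i) @` A,
          (fun x : euclid R n => x 0 i) @` B); first split => /=.
  - by apply: filterS FA => x Ax; exists x.
  - by apply: filterS FB => x Bx; exists x.
  move=> [_ _]/= [[x Ax <-] [y By <-]].
  rewrite /ball/=; have /= := AB (x, y) (conj Ax By).
  apply: le_lt_trans.
  have := coord_enorm ((x : 'rV_n) - y) i; by rewrite !mxE.
pose l : 'rV[R]_n := \row_i lim ((fun x : euclid R n => x 0 i) @ F).
apply/cvg_ex; exists (l : euclid R n); apply/cvgrPdist_le => e e0.
have dn : 0 < e / n.+1%:R by rewrite divr_gt0.
have : \forall x \near F, forall i, `|l 0 i - (x : 'rV_n) 0 i| <= e / n.+1%:R.
  apply: filter_forall => i; have := Fcoord i => /cvgrPdist_le/(_ _ dn).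
  by rewrite mxE.
apply: filterS => x xl; apply: (le_trans (enorm_sum ((l : 'rV_n) - x))).
apply: (@le_trans _ _ (\sum_(i < n) e / n.+1%:R)).
  by apply: ler_sum => i _; have := xl i; rewrite !mxE.
rewrite sumr_const card_ord -[leLHS]mulr_natr mulrAC ler_pdivrMr//.
by rewrite ler_wpM2l ?(ltW e0)// ler_nat.
Qed.

HB.instance Definition _ :=
  Uniform_isComplete.Build (euclid R n) euclid_complete.

HB.instance Definition _ := @CompleteNormedModule_isHilbert.Build R
  (euclid R n) edot edotC edot_linearl sqr_enorm.

End Euclid.

Section Operators.
Variables (R : realType) (E F : hilbertType R).

Definition bounded_op (f : E -> F) : Prop :=
  linear f /\ exists C : R, forall x, `|f x| <= C * `|x|.

Definition opnorm (f : E -> F) : R :=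
  sup [set `|f x| | x in [set x | `|x| <= 1]].

Definition is_adjoint (f : E -> F) (g : F -> E) : Prop :=
  forall x y, inner (f x) y = inner x (g y).

(* [is_adjoint f] has at most one element, and has one when [f] is bounded. *)
Definition adjoint (f : E -> F) : F -> E := [get g | is_adjoint f g].

End Operators.

Section SelfAdjoint.
Variables (R : realType) (H : hilbertType R).
Implicit Types A B : H -> H.

Definition calS A : Prop := bounded_op A /\ is_adjoint A A.

Definition op_le A B : Prop := forall x, inner (A x) x <= inner (B x) x.

Definition calS0 A : Prop := calS A /\ op_le (fun=> 0) A.

Definition calSpp A : Prop :=
  calS A /\ exists2 sigma : R, 0 < sigma & op_le (fun x => sigma *: x) A.

(* A^{1/2}; a positive self-adjoint operator has exactly one positive root *)
Definition sqrtop A : H -> H := [get B | calS0 B /\ B \o B = A].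

End SelfAdjoint.

Section Dimension.
Variables (R : realType) (H : hilbertType R) (r : nat).

Definition lincomb (v : 'I_r -> H) (a : euclid R r) : H :=
  \sum_i (a : 'rV_r) 0 i *: v i.

Definition lin_indep (v : 'I_r -> H) : Prop :=
  forall a : euclid R r, lincomb v a = 0 -> a = 0.

Definition has_dim (S : set H) : Prop :=
  exists2 v : 'I_r -> H, lin_indep v & S = range (lincomb v).

End Dimension.

Definition finite_rank (R : realType) (H : hilbertType R) (A : H -> H)
  (r : nat) : Prop := has_dim r (range A).

Section SetValued.
Variables (X Y : Type).

Definition setinv (T : X -> set Y) : Y -> set X := fun y => [set x | T x y].

Definition single (f : X -> Y) : X -> set Y := fun x => [set f x].

End SetValued.

(* Meaningful where [T x] is a singleton; the other points get a junk value. *)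
Definition valof (X : Type) (Y : pointedType) (T : X -> set Y) : X -> Y :=
  fun x => get (T x).

Section Monotone.
Variables (R : realType) (H : hilbertType R).
Implicit Types T S : H -> set H.

Definition monotone T : Prop :=
  forall x y u v, T x u -> T y v -> 0 <= inner (x - y) (u - v).

Definition maximally_monotone T : Prop :=
  monotone T /\
  forall S, monotone S -> (forall x, T x `<=` S x) -> forall x, S x = T x.

Definition strictly_monotone (l : H -> H) : Prop :=
  forall a b, a <> b -> 0 < inner (l a - l b) (a - b).

Definition invop (M : H -> H) : H -> H := valof (setinv (single M)).

(* J_T^M = (Id + M^{-1} T)^{-1} *)
Definition resolvent (M : H -> H) T : H -> H :=
  valof (setinv (fun x => [set x + invop M v | v in T x])).

End Monotone.

Section Reduced.
Variables (R : realType) (H : hilbertType R) (r : nat).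
Variables (Q : H -> H) (u : 'I_r -> H).

Local Notation U := (lincomb u).

(* U^* Q^{-1} U: the set of all U^* w with Q w = U a is a singleton when Q is
   self-adjoint and the u_i lie in its range. *)
Definition UQinvU : euclid R r -> euclid R r :=
  valof (fun a => adjoint U @` setinv (single Q) (U a)).

Definition ell (T : H -> set H) (M : H -> H) (s : R) (z : H)
    (a : euclid R r) : euclid R r :=
  UQinvU a + adjoint U (z - resolvent M T (z - s *: invop M (U a))).

End Reduced.

(* Main.v *)
(* x = J_T^M(y) means M (y - x) in T x; that such an x exists is Minty's theorem,
   proved by minimizing the strongly convex function F + (|x|^2 + |u|^2) / 2, F the
   Fitzpatrick function of T, and transported to the metric M by M^{-1/2}. Hence
   x = J_T^V(z) iff M (z - x) + s Q (z - x) in T x, whereas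
   x = J_T^M(z - s M^{-1} U a) iff M (z - x) - s U a in T x, and these agree once
   U a = Q (x - z). That is what l a = 0 says: if Q w = U a, then
   U^* (w + z - x) = 0 means that w + z - x is orthogonal to im Q, that is, lies
   in ker Q.
   For the other claims, put e := J_T^M(z - s M^{-1} U a) - J_T^M(z - s M^{-1} U b)
   and d := a - b. Monotonicity of T gives <M e, e> <= - s <e, U d>, so
   |M^{1/2} e| <= |M^{-1/2} U| |d|, whence the Lipschitz constant. With
   Q w = U d one has <l a - l b, d> = <Q w, w> - <e, Q w>; if s = 1 then
   - <e, Q w> >= 0, and if s = -1 then M - Q > 0 and <Q (w - e), w - e> >= 0
   make the difference positive. *)
Require Import Defs.
From HB Require Import structures.
From mathcomp Require Import all_boot all_order all_algebra.
From mathcomp Require Import boolp classical_sets reals topology normedtype.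
From mathcomp Require Import sequences ring lra.

Set Implicit Arguments.
Unset Strict Implicit.
Unset Printing Implicit Defensive.

Import Order.TTheory GRing.Theory Num.Theory.
Import numFieldNormedType.Exports.
Local Open Scope classical_set_scope.
Local Open Scope ring_scope.

(** * Inner product calculus and Cauchy-Schwarz inequalities *)

Section Inner.
Variables (R : realType) (E : hilbertType R).
Implicit Types x y z : E.

Lemma innerDl x y z : inner (x + y) z = inner x z + inner y z.
Proof. by rewrite -[x in LHS]scale1r inner_linearl mul1r. Qed.

Lemma inner0l z : inner 0 z = 0.
Proof. by have := innerDl 0 0 z; rewrite addr0; lra. Qed.

Lemma innerZl a x z : inner (a *: x) z = a * inner x z.
Proof. by rewrite -[a *: x]addr0 inner_linearl inner0l addr0. Qed.

Lemma innerNl x z : inner (- x) z = - inner x z.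
Proof. by rewrite -scaleN1r innerZl mulN1r. Qed.

Lemma innerDr x y z : inner z (x + y) = inner z x + inner z y.
Proof. by rewrite !(innerC z) innerDl. Qed.

Lemma inner0r z : inner z 0 = 0.
Proof. by rewrite innerC inner0l. Qed.

Lemma innerZr a x z : inner z (a *: x) = a * inner z x.
Proof. by rewrite !(innerC z) innerZl. Qed.

Lemma innerNr x z : inner z (- x) = - inner z x.
Proof. by rewrite !(innerC z) innerNl. Qed.

Definition innerE :=
  (innerDl, innerDr, innerNl, innerNr, innerZl, innerZr, inner0l, inner0r).

Lemma inner_ge0 x : 0 <= inner x x.
Proof. by rewrite -sqr_normE sqr_ge0. Qed.

Lemma inner_eq0 x : inner x x <= 0 -> x = 0.
Proof.
rewrite -sqr_normE => h; apply/eqP; rewrite -normr_eq0 -sqrf_eq0.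
by rewrite eq_le h sqr_ge0.
Qed.

(* Turns vector identities into scalar ones, which [ring] decides. *)
Lemma inner_inj x y : (forall z, inner x z = inner y z) -> x = y.
Proof.
move=> xy; apply/eqP; rewrite -subr_eq0; apply/eqP/inner_eq0.
by rewrite innerDl innerNl xy subrr.
Qed.

Lemma inner_suml (I : finType) (f : I -> E) z :
  inner (\sum_i f i) z = \sum_i inner (f i) z.
Proof.
by apply: (big_ind2 (fun x a => inner x z = a)); rewrite ?inner0l//
  => x a y b <- <-; rewrite innerDl.
Qed.

End Inner.

Lemma linear_facts (R : realType) (E F : hilbertType R) (f : E -> F) :
  linear f ->
  [/\ f 0 = 0, {morph f : x y / x + y}, {morph f : x / - x},
      {morph f : x y / x - y} & forall a, {morph f : x / a *: x}].
Proof.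
move=> lf.
have f0 : f 0 = 0 by have := lf (-1) 0 0; rewrite scaler0 addr0 scaleN1r addNr.
have fD : {morph f : x y / x + y} by move=> x y; have := lf 1 x y; rewrite !scale1r.
have fZ a : {morph f : x / a *: x} by move=> x; have := lf a x 0; rewrite f0 !addr0.
have fN : {morph f : x / - x} by move=> x; rewrite -scaleN1r fZ scaleN1r.
by split=> // x y; rewrite fD fN.
Qed.

Lemma linear_id (R : realType) (E : hilbertType R) : linear (@id E).
Proof. by []. Qed.

Section CauchySchwarz.
Variables (R : realType) (E : hilbertType R).
Implicit Types (x y : E) (A : E -> E).

(** The quadratic [t |-> <A (x + t y), x + t y>] is nonnegative, so its discriminant is not
    positive. *)
Lemma psd_CauchySchwarz A : linear A -> is_adjoint A A ->
  (forall x, 0 <= inner (A x) x) ->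
  forall x y, inner (A x) y ^+ 2 <= inner (A x) x * inner (A y) y.
Proof.
move=> lA sA pA x y; have [_ AD _ _ AZ] := linear_facts lA.
have quad t : 0 <= inner (A x) x + 2 * t * inner (A x) y + t ^+ 2 * inner (A y) y.
  have := pA (x + t *: y).
  by rewrite AD AZ !innerE (sA y x) (innerC y); congr (0 <= _); ring.
set a := inner (A x) x in quad *; set b := inner (A x) y in quad *.
set c := inner (A y) y in quad *.
have c0 : 0 <= c by exact: pA.
have a0 : 0 <= a by exact: pA.
move: c0; rewrite le_eqVlt => /predU1P[c0|c0].
  have [->|b0] := eqVneq b 0; first by rewrite expr0n mulr_ge0// -c0.
  (* With [c = 0] the quadratic is affine in [t]; this [t] gives it the value -1. *)
  have := quad (- (a + 1) / (2 * b)); rewrite -c0.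
  have -> : a + 2 * (- (a + 1) / (2 * b)) * b + (- (a + 1) / (2 * b)) ^+ 2 * 0
     = -1 by field.
  by rewrite oppr_ge0 ler10.
have := quad (- b / c); rewrite -(pmulr_rge0 _ c0).
have -> : c * (a + 2 * (- b / c) * b + (- b / c) ^+ 2 * c) = a * c - b ^+ 2.
  by field; rewrite gt_eqF.
by rewrite subr_ge0.
Qed.

Lemma inner_CauchySchwarz x y : inner x y <= `|x| * `|y|.
Proof.
have := psd_CauchySchwarz (@linear_id _ E) (fun _ _ => erefl) (@inner_ge0 _ E) x y.
rewrite -!sqr_normE -exprMn => h.
rewrite (le_trans (ler_norm _))// -ler_sqr ?nnegrE ?mulr_ge0//.
by rewrite real_normK ?num_real.
Qed.

(** Cauchy-Schwarz for the form of [A] at [x] and [A x] gives [|A x|^4 <= q |x|^2 * q |A x|^2]. *)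
Lemma psd_norm_le A (q : R) : linear A -> is_adjoint A A -> 0 <= q ->
  (forall x, 0 <= inner (A x) x) -> (forall x, inner (A x) x <= q * `|x| ^+ 2) ->
  forall x, `|A x| <= q * `|x|.
Proof.
move=> lA sA q0 pA Aq x.
have := psd_CauchySchwarz lA sA pA x (A x).
rewrite -sqr_normE.
have [->|n0] := eqVneq `|A x| 0; first by rewrite mulr_ge0.
move=> h; rewrite -ler_sqr ?nnegrE ?mulr_ge0// exprMn.
have np : 0 < `|A x| ^+ 2 by rewrite exprn_gt0// lt_def n0/=.
rewrite -(ler_pM2r np) -expr2 (le_trans h)//.
rewrite (le_trans (ler_pM (pA _) (pA _) (Aq _) (Aq _)))//.
by rewrite le_eqVlt; apply/orP; left; apply/eqP; ring.
Qed.

Lemma psd_eq0 A x : linear A -> is_adjoint A A ->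
  (forall x, 0 <= inner (A x) x) -> inner (A x) x <= 0 -> A x = 0.
Proof.
move=> lA sA pA Ax; apply: inner_eq0.
have := psd_CauchySchwarz lA sA pA x (A x).
have -> : inner (A x) x = 0 by apply/eqP; rewrite eq_le Ax pA.
by rewrite mul0r => h; have := sqr_ge0 (inner (A x) (A x) - 1); nra.
Qed.

End CauchySchwarz.

(** * Limits with a geometric rate *)

Section Geometric.
Variables (R : realType) (q : R).
Hypotheses (q0 : 0 <= q) (q1 : q < 1).

(** Lets later proofs pass to the limit: an inequality that holds up to an error [C * q ^+ n] for
    every [n] holds exactly. *)
Lemma le0_geometric (a C : R) : (forall n, a <= C * q ^+ n) -> a <= 0.
Proof.
move=> h; have : geometric C q n @[n --> \oo] --> 0.
  by apply: cvg_geometric; rewrite ger0_norm.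
by move=> /cvgr_to_ge; apply; apply: nearW => n; exact: h.
Qed.

Lemma geometric_steps (V : completeNormedModType R) (x : nat -> V) (C : R) :
  0 <= C -> (forall n, `|x n.+1 - x n| <= C * q ^+ n) ->
  exists l, forall n, `|l - x n| <= C / (1 - q) * q ^+ n.
Proof.
move=> C0 xC.
have tail n k : `|x (n + k)%N - x n| <= C / (1 - q) * q ^+ n.
  have q10 : 0 < 1 - q by rewrite subr_gt0.
  (* Keeping the difference of powers makes the induction on [k] telescope. *)
  apply: (@le_trans _ _ (C / (1 - q) * (q ^+ n - q ^+ (n + k)))); last first.
    by rewrite ler_wpM2l ?divr_ge0 ?(ltW q10)// gerBl exprn_ge0.
  elim: k => [|k IH]; first by rewrite addn0 !subrr normr0 mulr0.
  rewrite addnS; apply: (le_trans (ler_distD (x (n + k)%N) _ _)).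
  apply: (le_trans (lerD (xC _) IH)); rewrite le_eqVlt; apply/orP; left.
  by apply/eqP; rewrite exprS; field; rewrite gt_eqF.
set K := C / (1 - q) in tail *.
have Kq : K * q ^+ n @[n --> \oo] --> 0.
  by apply: (@cvg_geometric _ K); rewrite ger0_norm.
have : cvg (x @ \oo).
  apply/cauchy_cvgP/cauchy_exP => e e0.
  have [N _ hN] : \forall n \near \oo, K * q ^+ n < e by exact: (cvgr_lt _ Kq).
  exists (x N); exists N => // k /= Nk; rewrite -ball_normE/= distrC.
  by rewrite -(subnKC Nk) (le_lt_trans (tail _ _))//; apply: hN => /=.
move=> /cvg_ex[l xl]; exists l => n.
apply: (cvgr_to_le (cvg_norm (cvgB xl (cvg_cst (x n))))).
by exists n => // k /= nk; rewrite -(subnKC nk) tail.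
Qed.

End Geometric.

(** * Square root of a strictly positive operator *)

Section SquareRoot.
Variables (R : realType) (E : hilbertType R).
Implicit Types (x y : E) (A B X Y : E -> E).

Lemma calSpp_bounds A : calSpp A ->
  exists2 C : R, 0 < C &
    exists2 sigma, 0 < sigma <= C &
      (forall x, `|A x| <= C * `|x|) /\
      (forall x, sigma * `|x| ^+ 2 <= inner (A x) x).
Proof.
move=> [[[_ [C AC]] _] [sigma s0 As]].
(* The enlarged constant is positive and at least [sigma]. *)
have AC' x : `|A x| <= (`|C| + sigma) * `|x|.
  apply: (le_trans (AC x)); rewrite ler_wpM2r//.
  by have := ler_norm C; lra.
have C0 := normr_ge0 C.
exists (`|C| + sigma); first by lra.
exists sigma; first by lra.
by split=> // x; have := As x; rewrite innerZl sqr_normE.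
Qed.

Lemma norm_half_le x (a : R) : `|x| <= a + a -> `|2^-1 *: x| <= a.
Proof. by rewrite normrZ ger0_norm ?invr_ge0//; lra. Qed.

Section Iteration.
Variables (X : E -> E) (q : R).
Hypotheses (lX : linear X) (sX : is_adjoint X X).
Hypotheses (q0 : 0 <= q) (q1 : q < 1) (Xq : forall x, `|X x| <= q * `|x|).

(* A fixed point [Y = (X + Y^2) / 2] satisfies [(1 - Y)^2 = 1 - X]. *)
Fixpoint sqrt_iter n : E -> E :=
  if n is m.+1 then fun x => 2^-1 *: (X x + sqrt_iter m (sqrt_iter m x))
  else fun=> 0.

Local Notation Y := sqrt_iter.

Lemma sqrt_iter_linear n : linear (Y n).
Proof.
elim: n => [|n IH] a x y /=; first by rewrite scaler0 addr0.
rewrite lX !IH !scalerDr !scalerA [a * _]mulrC -!addrA; congr (_ + _).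
by rewrite addrCA.
Qed.

Lemma sqrt_iter_adjoint n : is_adjoint (Y n) (Y n).
Proof.
elim: n => [|n IH] x y /=; first by rewrite !innerE.
by rewrite !innerE sX !IH.
Qed.

Lemma sqrt_iter_le n x : `|Y n x| <= q * `|x|.
Proof.
elim: n x => [|n IH] x /=; first by rewrite normr0 mulr_ge0.
apply: norm_half_le; rewrite (le_trans (ler_normD _ _))// lerD//.
rewrite (le_trans (IH _))// ler_wpM2l// (le_trans (IH _))//.
by rewrite -[leRHS]mul1r ler_wpM2r// ltW.
Qed.

(** A difference of squares splits as [Y'^2 - Y^2 = (Y' - Y) Y' + Y (Y' - Y)]. Each term gains a
    factor [q] over the previous step, and the factor 1/2 absorbs the sum. *)
Lemma sqrt_iter_step n x : `|Y n.+1 x - Y n x| <= `|x| * q ^+ n.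
Proof.
elim: n x => [|n IH] x.
  rewrite /= addr0 subr0 expr0 mulr1; apply: norm_half_le.
  have := Xq x; have : q * `|x| <= `|x| by rewrite -[leRHS]mul1r ler_wpM2r// ltW.
  by have := normr_ge0 x; lra.
have [_ _ _ YB _] := linear_facts (sqrt_iter_linear n).
have -> : Y n.+2 x - Y n.+1 x =
    2^-1 *: ((Y n.+1 (Y n.+1 x) - Y n (Y n.+1 x)) + Y n (Y n.+1 x - Y n x)).
  rewrite YB addrA subrK.
  transitivity (2^-1 *: (X x + Y n.+1 (Y n.+1 x)) - 2^-1 *: (X x + Y n (Y n x))).
    by [].
  by rewrite -scalerBr opprD addrACA subrr add0r.
apply: norm_half_le; rewrite (le_trans (ler_normD _ _))// lerD//.
  rewrite (le_trans (IH _))// exprS mulrA ler_wpM2r ?exprn_ge0//.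
  by rewrite mulrC sqrt_iter_le.
rewrite (le_trans (sqrt_iter_le _ _))// exprS mulrCA ler_wpM2l//.
Qed.

(** The pointwise limit [L] of the iterates. Each property is inherited from [Y n] with an error
    controlled by [d n x = L x - Y n x], which decays geometrically. *)
Lemma sqrt_iter_lim : exists Y : E -> E,
  [/\ linear Y, is_adjoint Y Y, forall x, `|Y x| <= q * `|x| &
      forall x, Y x = 2^-1 *: (X x + Y (Y x))].
Proof.
have step x := geometric_steps q0 q1 (normr_ge0 x) (sqrt_iter_step^~ x).
pose L x := sval (cid (step x)).
pose d n x := L x - Y n x.
have dL n x : L x = Y n x + d n x by rewrite addrC subrK.
have dP n x : `|d n x| <= `|x| / (1 - q) * q ^+ n by exact: svalP (cid (step x)) n.
clearbody d L.
have dPl n x y : inner (d n x) y <= `|x| / (1 - q) * `|y| * q ^+ n.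
  by rewrite (le_trans (inner_CauchySchwarz _ _))// mulrAC ler_wpM2r.
have dPr n x y : inner y (d n x) <= `|x| / (1 - q) * `|y| * q ^+ n.
  by rewrite innerC.
have le0 K x : (forall n, `|x| <= K * q ^+ n) -> x = 0.
  move=> h; have := le0_geometric q0 q1 h; rewrite normr_le0 => /eqP; exact.
have YL n := linear_facts (sqrt_iter_linear n).
have lL : linear L.
  move=> a x y; apply/eqP; rewrite -subr_eq0; apply/eqP.
  apply: (le0 ((`|a *: x + y| + `|a| * `|x| + `|y|) / (1 - q))) => n.
  rewrite !(dL n) (sqrt_iter_linear n a x y).
  have -> : a *: Y n x + Y n y + d n (a *: x + y) - (a *: (Y n x + d n x)
     + (Y n y + d n y)) = d n (a *: x + y) - a *: d n x - d n y.
    by apply: inner_inj => w; rewrite !innerE; ring.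
  rewrite (le_trans (ler_normB _ _))// !mulrDl lerD// (le_trans (ler_normB _ _))//.
  by rewrite lerD// normrZ -!mulrA ler_wpM2l// mulrA.
have Lq x : `|L x| <= q * `|x|.
  rewrite -subr_le0; apply: (le0_geometric q0 q1 (C := `|x| / (1 - q))) => n.
  rewrite lerBlDr (dL n) addrC (le_trans (ler_normD _ _))// lerD//.
  exact: sqrt_iter_le.
exists L; split=> //.
  have half x y : inner (L x) y <= inner x (L y).
    rewrite -subr_le0; apply: (le0_geometric q0 q1
      (C := (`|x| / (1 - q) * `|y|) + (`|y| / (1 - q) * `|x|))) => n.
    rewrite (dL n x) (dL n y) !innerE sqrt_iter_adjoint mulrDl.
    have := dPl n x y; have := dPr n y (- x); rewrite normrN !innerE; lra.
  by move=> x y; apply/eqP; rewrite eq_le half/= innerC (innerC _ y) half.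
move=> x; apply/eqP; rewrite -subr_eq0; apply/eqP.
apply: (le0 (2 * (`|x| + `|L x|) / (1 - q))) => n.
have [_ YD _ _ _] := YL n.
have -> : L x - 2^-1 *: (X x + L (L x)) =
    d n.+1 x - 2^-1 *: (Y n (d n x) + d n (L x)).
  have e : Y n (L x) = Y n (Y n x) + Y n (d n x) by rewrite -YD -dL.
  rewrite (dL n (L x)) e (dL n.+1 x) -[Y n.+1 x]/(2^-1 *: (X x + Y n (Y n x))).
  by apply: inner_inj => w; rewrite !innerE; ring.
set a := `|x| / (1 - q) * q ^+ n; set b := `|L x| / (1 - q) * q ^+ n.
have -> : 2 * (`|x| + `|L x|) / (1 - q) * q ^+ n = a + (a + b + b).
  by rewrite /a /b; ring.
have K0 z : 0 <= `|z| / (1 - q) by rewrite divr_ge0// subr_ge0 ltW.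
have b0 : 0 <= b by rewrite mulr_ge0// exprn_ge0.
have a0 : 0 <= a by rewrite mulr_ge0// exprn_ge0.
rewrite (le_trans (ler_normB _ _))// lerD//.
  rewrite (le_trans (dP _ _))// ler_wpM2l// exprS -[leRHS]mul1r.
  by rewrite ler_wpM2r ?exprn_ge0// ltW.
apply: norm_half_le; rewrite (le_trans (ler_normD _ _))//.
have : `|Y n (d n x)| <= a.
  rewrite (le_trans (sqrt_iter_le _ _))// (le_trans _ (dP n x))//.
  by rewrite -[leRHS]mul1r ler_wpM2r// ltW.
by have : `|d n (L x)| <= b by []; lra.
Qed.

End Iteration.

(** Write [A = C (1 - X)]; then [0 <= X <= q] with [q = 1 - sigma / C < 1], so the iteration applies
    to [X] and the root is [sqrt C * (1 - Y)]. *)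
Lemma calSpp_sqrt A : calSpp A -> exists B, calS0 B /\ B \o B = A.
Proof.
move=> SA; have [C C0 [sigma /andP[s0 sC] [AC As]]] := calSpp_bounds SA.
have [[[lA _] sA] _] := SA; have [_ AD AN AB AZ] := linear_facts lA.
pose X x := x - C^-1 *: A x.
pose q := 1 - sigma / C.
have q0 : 0 <= q by rewrite subr_ge0 ler_pdivrMr// mul1r.
have q1 : q < 1 by rewrite /q; have := divr_gt0 s0 C0; lra.
have lX : linear X.
  by move=> a x y; apply: inner_inj => w; rewrite /X lA !innerE; ring.
have sX : is_adjoint X X by move=> x y; rewrite /X !innerE sA.
have XE x : inner (X x) x = `|x| ^+ 2 - C^-1 * inner (A x) x.
  by rewrite /X !innerE sqr_normE.
have Xq : forall x, `|X x| <= q * `|x|.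
  apply: psd_norm_le => // x; rewrite XE.
    rewrite subr_ge0 mulrC ler_pdivrMr// (le_trans (inner_CauchySchwarz _ _))//.
    by rewrite expr2 mulrAC ler_wpM2r// mulrC.
  rewrite mulrBl mul1r lerD2l lerN2 (mulrC sigma) -mulrA.
  by rewrite ler_wpM2l ?invr_ge0 ?(ltW C0)//.
have [Y [lY sY Yq YE]] := sqrt_iter_lim lX sX q0 q1 Xq.
have [_ YD YN YB YZ] := linear_facts lY.
pose c := Num.sqrt C.
have c2 : c ^+ 2 = C by rewrite sqr_sqrtr// ltW.
have c0 : 0 <= c by exact: sqrtr_ge0.
exists (fun x => c *: (x - Y x)); split; last first.
  apply/funext => x /=; rewrite YZ -scalerBr scalerA -expr2 c2 YB.
  have Y2 : Y x + Y x = X x + Y (Y x).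
    rewrite -mulr2n -scaler_nat [in LHS]YE scalerA divff ?scale1r ?pnatr_eq0//.
  have -> : x - Y x - (Y x - Y (Y x)) = C^-1 *: A x.
    apply: inner_inj => w; have := congr1 (inner^~ w) Y2.
    by rewrite /X !innerE => h; lra.
  by rewrite scalerA divff ?scale1r// gt_eqF.
split; [split; [split|]|].
- by move=> a x y; apply: inner_inj => w; rewrite lY !innerE; ring.
- exists (c * (1 + q)) => x; rewrite normrZ ger0_norm// -mulrA ler_wpM2l//.
  by rewrite (le_trans (ler_normB _ _))// mulrDl mul1r lerD2l.
- by move=> x y; rewrite !innerE sY.
- move=> x; rewrite !innerE mulr_ge0// -sqr_normE subr_ge0.
  rewrite (le_trans (inner_CauchySchwarz _ _))// expr2 ler_wpM2r//.
  by rewrite (le_trans (Yq _))// -[leRHS]mul1r ler_wpM2r// ltW.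
Qed.
End SquareRoot.

(** * Minty's theorem *)

Section Minty.
Variables (R : realType) (E : hilbertType R).
Implicit Types (T : E -> set E) (x y u v : E).

(** Adjoining [(x, u)] to the graph keeps it monotone, so by maximality it was already there. *)
Lemma maximally_monotone_mem T x u : maximally_monotone T ->
  (forall y v, T y v -> 0 <= inner (x - y) (u - v)) -> T x u.
Proof.
move=> [mT maxT] xu.
pose S y := [set v | T y v \/ y = x /\ v = u].
rewrite -(maxT S); first by right.
  move=> y y' v v' [yv|[-> ->]] [y'v'|[-> ->]].
  - exact: mT.
  - by have := xu _ _ yv; rewrite -[y - x]opprB -[v - u]opprB innerNl innerNr opprK.
  - exact: xu.
  - by rewrite !subrr inner0l.
by move=> y v yv; left.
Qed.

Variable T : E -> set E.
Hypothesis mT : monotone T.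
(** Maximality enters in this form, which is checked directly for each operator to which [minty] is
    applied. *)
Hypothesis memT : forall x u,
  (forall y v, T y v -> 0 <= inner (x - y) (u - v)) -> T x u.

(** The supremum of [phi y v x u] over the graph is [F(x, u) + (|x|^2 + |u|^2) / 2], [F] the
    Fitzpatrick function. [below] bounds it without forming a supremum that may be infinite. *)
Let phi y v x u : R :=
  inner y u + inner x v - inner y v + (inner x x + inner u u) / 2.

Let below c x u := forall y v, T y v -> phi y v x u <= c.

Let levels := [set c | exists x u, below c x u].

(** This is [F(x, u) >= <x, u>]: otherwise [(x, u)] would be monotonically related to the graph,
    hence in it, and testing with [(x, u)] itself gives a contradiction. *)
Lemma below_ge c x u : below c x u -> inner x u + (inner x x + inner u u) / 2 <= c.
Proof.
move=> cxu; rewrite leNgt; apply/negP => clt.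
suff Txu : T x u by have := cxu _ _ Txu; rewrite /phi; lra.
by apply: memT => y v yv; have := cxu _ _ yv; rewrite /phi !innerE; lra.
Qed.

Lemma levels_ge0 c : levels c -> 0 <= c.
Proof.
move=> [x [u /below_ge]]; have := inner_ge0 (x + u).
by rewrite !innerE (innerC u x); lra.
Qed.

Lemma graph_below y v : T y v ->
  below (inner y v + (inner y y + inner v v) / 2) y v.
Proof. by move=> yv y' v' yv'; have := mT yv yv'; rewrite /phi !innerE; lra. Qed.

Lemma levels_has_inf : has_inf levels.
Proof.
split; last by exists 0 => c /levels_ge0.
have [[y [v yv]]|noT] := pselect (exists y v, T y v).
  by eexists; exists y, v; exact: graph_below.
(* Over an empty graph every bound holds vacuously. *)
exists 0, 0, 0 => y v yv; exfalso; apply: noT; by exists y, v.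
Qed.

(* [phi y v] is a quadratic function with Hessian the identity, so the level of
   a convex combination drops by [t (1 - t) / 2] times the squared distance. *)
Lemma below_convex t c c' x u x' u' : 0 <= t <= 1 ->
  below c x u -> below c' x' u' ->
  below ((1 - t) * c + t * c'
         - t * (1 - t) / 2 * (`|x' - x| ^+ 2 + `|u' - u| ^+ 2))
    ((1 - t) *: x + t *: x') ((1 - t) *: u + t *: u').
Proof.
move=> /andP[t0 t1] cxu cxu' y v yv.
have h : (1 - t) * phi y v x u <= (1 - t) * c.
  by rewrite ler_wpM2l ?subr_ge0// cxu.
have h' : t * phi y v x' u' <= t * c' by rewrite ler_wpM2l ?cxu'.
rewrite -[X in _ <= X - _]/(_ + _); apply: le_trans (lerD (lerD h h') (lexx _)).
rewrite !sqr_normE /phi !innerE (innerC x' x) (innerC u' u).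
by rewrite le_eqVlt; apply/orP; left; apply/eqP; field.
Qed.

Let m := inf levels.

Lemma level_min c x u : below c x u -> m <= c.
Proof.
by move=> cxu; apply: ge_inf; [case: levels_has_inf|exists x, u].
Qed.

(** A minimizing sequence is Cauchy, since midpoints of consecutive points cannot fall below the
    infimum. *)
Lemma minimizer : exists x u, below m x u.
Proof.
have p4 n : 0 < (4^-1 : R) ^+ n by apply: exprn_gt0; lra.
have lev n : exists xu : E * E, below (m + 4^-1 ^+ n) xu.1 xu.2.
  have [c [x [u cxu]] cm] := inf_adherent (p4 n) levels_has_inf.
  by exists (x, u) => y v yv; apply: le_trans (ltW cm); apply: cxu.
have /choice[xu xuP] := lev.
pose x n := (xu n).1; pose u n := (xu n).2.
(* Convexity with [t = 1/2] yields the bound [5 * 4^-n], rounded up to the square [9 * 4^-n]. *)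
have stepD n : `|x n.+1 - x n| ^+ 2 + `|u n.+1 - u n| ^+ 2 <= (3 * 2^-1 ^+ n) ^+ 2.
  have h01 : 0 <= (2^-1 : R) <= 1 by apply/andP; split; lra.
  have := level_min (below_convex h01 (xuP n) (xuP n.+1)).
  have -> : (3 * 2^-1 ^+ n) ^+ 2 = 9 * (4^-1 : R) ^+ n.
    have -> : 4^-1 = (2^-1 : R) ^+ 2 by field.
    by rewrite exprMn exprAC; ring.
  by have := p4 n; rewrite exprS -/(x n) -/(u n) -/(x n.+1) -/(u n.+1); lra.
have step3 (a b : E) n : `|a| ^+ 2 + `|b| ^+ 2 <= (3 * 2^-1 ^+ n) ^+ 2 ->
    `|a| <= 3 * 2^-1 ^+ n.
  move=> h; rewrite -ler_sqr ?nnegrE ?mulr_ge0 ?exprn_ge0 ?invr_ge0//.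
  by have := sqr_ge0 `|b|; lra.
have q0 : 0 <= 2^-1 :> R by lra.
have q1 : 2^-1 < 1 :> R by lra.
have stepx n : `|x n.+1 - x n| <= 3 * 2^-1 ^+ n.
  exact: step3 (stepD n).
have stepu n : `|u n.+1 - u n| <= 3 * 2^-1 ^+ n.
  by apply: (step3 _ (x n.+1 - x n)); rewrite addrC.
have C0 : 0 <= 3 :> R by [].
have [x0 x0P] := geometric_steps q0 q1 C0 stepx.
have [u0 u0P] := geometric_steps q0 q1 C0 stepu.
exists x0, u0 => y v yv; rewrite -subr_le0.
set K := 3 / (1 - 2^-1) in x0P u0P.
(* Expand [phi y v] at [(x0, u0)]: its gradient there is [(v + x0, y + u0)], and the quadratic
   remainder has the favourable sign. The 1 accounts for the excess [4^-n] of the level. *)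
apply: (le0_geometric q0 q1 (C := 1 + K * `|y + u0| + K * `|v + x0|)) => n.
have a1 : inner (u0 - u n) (y + u0) <= K * `|y + u0| * 2^-1 ^+ n.
  by rewrite (le_trans (inner_CauchySchwarz _ _))// mulrAC ler_wpM2r.
have a2 : inner (x0 - x n) (v + x0) <= K * `|v + x0| * 2^-1 ^+ n.
  by rewrite (le_trans (inner_CauchySchwarz _ _))// mulrAC ler_wpM2r.
have a3 : (4^-1 : R) ^+ n <= 2^-1 ^+ n by rewrite lerXn2r ?nnegrE//; lra.
have a4 := xuP n y v yv.
have a5 := inner_ge0 (x0 - x n); have a6 := inner_ge0 (u0 - u n).
move: a4 a1 a2 a5 a6; rewrite -/(x n) -/(u n) /phi !innerE !mulrDl mul1r.
rewrite (innerC u0 y) (innerC (u n) y) (innerC (u n) u0) (innerC (x n) x0).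
by lra.
Qed.

(* A minimizer [(x, u)] of the strongly convex [F + (|x|^2 + |u|^2) / 2], [F] the
   Fitzpatrick function of [T], satisfies [<y + u, v + x> >= |x + u|^2] for all
   [(y, v)] in the graph; hence [(- u, - x)] is in the graph and [u = - x]. *)
Lemma minty : exists x, T x (- x).
Proof.
have [x [u mxu]] := minimizer.
have opt y v : T y v -> `|x + u| ^+ 2 <= inner (y + u) (v + x).
  move=> yv; set D := `|y - x| ^+ 2 + `|v - u| ^+ 2.
  set N := inner y v + (inner y y + inner v v) / 2.
  (* Move from the minimizer towards [(y, v)] by a fraction [t] and divide the gain by [t]; below,
     [t = 2^-n] tends to 0. *)
  have lam (t : R) : 0 < t <= 1 -> 0 <= N - m - D / 2 + t * (D / 2).
    move=> /andP[t0 t1]; have t01 : 0 <= t <= 1 by rewrite ltW.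
    have := level_min (below_convex t01 mxu (graph_below yv)).
    rewrite -/N -/D -(pmulr_rge0 _ t0) => h.
    by rewrite -subr_ge0 in h; move: h; congr (0 <= _); field.
  have D0 : 0 <= D by rewrite addr_ge0 ?sqr_ge0.
  have lim0 : 0 <= N - m - D / 2.
    rewrite -oppr_le0; apply: (@le0_geometric _ 2^-1 _ _ _ (D / 2)); [lra|lra|] => n.
    have h01 : 0 < (2^-1 : R) ^+ n <= 1.
      by rewrite exprn_gt0 ?exprn_ile1 ?invr_ge0 ?invr_gt0 ?invf_le1 ?ler1n.
    by have := lam _ h01; lra.
  have := below_ge mxu; move: lim0.
  rewrite /N /D !sqr_normE !innerE (innerC x y) (innerC u v) (innerC u x).
  by lra.
have Tux : T (- u) (- x).
  apply: memT => y v /opt; have := sqr_ge0 `|x + u|.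
  by rewrite -[- u - y]opprD -[- x - v]opprD innerNl innerNr opprK
    (addrC u y) (addrC x v); lra.
have := opt _ _ Tux; rewrite !addNr inner0l sqr_normE => /inner_eq0 xu0.
have ux : x = - u by apply/eqP; rewrite -addr_eq0 xu0.
by exists x; rewrite {1}ux.
Qed.

End Minty.

(** * Inverses and resolvents *)

Section Inverse.
Variables (R : realType) (E : hilbertType R) (M : E -> E).
Hypothesis SM : calSpp M.

Lemma calSpp_linear : linear M.
Proof. by have [[[]]] := SM. Qed.

Let MF := linear_facts calSpp_linear.

Lemma calSpp_adjoint : is_adjoint M M.
Proof. by have [[]] := SM. Qed.

Lemma calSpp_inner_le0 x : inner (M x) x <= 0 -> x = 0.
Proof.
have [C C0 [sigma /andP[s0 _] [_ Ms]]] := calSpp_bounds SM => Mx.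
apply: inner_eq0; rewrite -sqr_normE.
by have := le_trans (Ms x) Mx; rewrite pmulr_rle0.
Qed.

Lemma calSpp_inj x y : M x = M y -> x = y.
Proof.
move=> e; apply/eqP; rewrite -subr_eq0; apply/eqP/calSpp_inner_le0.
by have [_ _ _ -> _] := MF; rewrite e subrr inner0l.
Qed.

(* [M x = y] amounts to [- x = N x] for the monotone affine map
   [N x = sigma^-1 (M x - y) - x]. *)
Lemma calSpp_surj y : exists x, M x = y.
Proof.
have [C C0 [sigma /andP[s0 _] [_ Ms]]] := calSpp_bounds SM.
have [_ MD MN MB MZ] := MF.
pose N x := sigma^-1 *: (M x - y) - x.
have mono x : 0 <= sigma^-1 * inner (M x) x - inner x x.
  rewrite subr_ge0 -(ler_pM2l s0) mulrA divff ?gt_eqF// mul1r -sqr_normE.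
  exact: Ms.
suff [x xN] : exists x, - x = N x.
  exists x; apply/eqP; rewrite -subr_eq0.
  have /eqP := congr1 (+%R^~ x) xN; rewrite /N addNr subrK eq_sym.
  by rewrite scaler_eq0 invr_eq0 gt_eqF.
apply: (minty (T := fun x => [set N x])).
  move=> a b _ _ -> ->; have := mono (a - b).
  rewrite MB /N !innerE !(innerC (M _)); lra.
move=> x u xu /=; apply/eqP; rewrite -subr_eq0; apply/eqP.
set h := u - N x; apply: inner_eq0.
(* Testing with [x + t h] and dividing by [t] gives [|h|^2 <= t K]; then [t = 2^-n] tends to 0. *)
pose K := `|sigma^-1 * inner (M h) h - inner h h|.
apply: (@le0_geometric _ 2^-1 _ _ _ K); [lra|lra|] => n.
have t0 : 0 < (2^-1 : R) ^+ n by rewrite exprn_gt0 ?invr_gt0.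
set t := _ ^+ n in t0 *.
have := xu (x + t *: h) _ erefl.
have -> : x - (x + t *: h) = - (t *: h) by rewrite opprD addrA subrr add0r.
have -> : u - N (x + t *: h) = h - t *: (sigma^-1 *: M h - h).
  by rewrite /h /N MD MZ; apply: inner_inj => w; rewrite !innerE; ring.
clearbody h; rewrite innerNl innerZl -mulrN pmulr_rge0// !innerE (innerC h (M h)) => h0.
rewrite mulrC; apply: (@le_trans _ _ (t * (sigma^-1 * inner (M h) h - inner h h))).
  by lra.
by rewrite ler_wpM2l ?ler_norm// ltW.
Qed.

Lemma invopK y : M (invop M y) = y.
Proof.
have [x xy] := calSpp_surj y.
suff : setinv (single M) y (invop M y) by rewrite /setinv/single/=.
by apply: getPex; exists x.
Qed.

Lemma invopKV x : invop M (M x) = x.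
Proof. by apply: calSpp_inj; rewrite invopK. Qed.

Lemma invop_calSpp : calSpp (invop M).
Proof.
have [C C0 [sigma /andP[s0 _] [MC Ms]]] := calSpp_bounds SM.
have sI : is_adjoint (invop M) (invop M).
  by move=> x y; rewrite -{2}[x]invopK calSpp_adjoint invopK.
split; [split; [split|]|] => //.
- by move=> a x y; apply: calSpp_inj; rewrite calSpp_linear !invopK.
- exists sigma^-1 => y; set x := invop M y.
  rewrite mulrC ler_pdivlMr//.
  have [->|x0] := eqVneq x 0; first by rewrite normr0 mul0r.
  have xp : 0 < `|x| by rewrite normr_gt0.
  rewrite -(ler_pM2r xp) mulrC mulrA -expr2 mulrC (le_trans (Ms x))//.
  by rewrite /x invopK inner_CauchySchwarz.
(* With [y = M x], [<x, M x> >= sigma |x|^2] and [|y| <= C |x|]. *)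
- exists (sigma / C ^+ 2); first by rewrite divr_gt0// exprn_gt0.
  move=> y; set x := invop M y; rewrite innerZl -sqr_normE.
  have -> : y = M x by rewrite invopK.
  rewrite (innerC x) (le_trans _ (Ms x))// -mulrA ler_wpM2l ?(ltW s0)//.
  rewrite mulrC ler_pdivrMr ?exprn_gt0// mulrC -exprMn ler_sqr ?nnegrE//.
  by rewrite mulr_ge0// ltW.
Qed.

Lemma sqrtop_invop :
  calS0 (sqrtop (invop M)) /\ sqrtop (invop M) \o sqrtop (invop M) = invop M.
Proof. exact: getPex (calSpp_sqrt invop_calSpp). Qed.

Section Resolvent.
Variable T : E -> set E.
Hypothesis hT : maximally_monotone T.

(* Minty's theorem in the metric [M], transported to the original metric by
   [B = M^{-1/2}]: the operator [x |-> B (T (z + B x))] is maximally monotone. *)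
Lemma minty_metric z : exists x, T x (M (z - x)).
Proof.
have [_ MD MN MB MZ] := MF.
have [] := sqrtop_invop; set B := sqrtop _ => -[[[lB _] sB] _] BB.
have BBE x : B (B x) = invop M x by rewrite -BB.
have [_ BD BN BB' BZ] := linear_facts lB.
have [x [v Tv e]] : exists x, [set B v | v in T (z + B x)] (- x).
  apply: (minty (T := fun x => [set B v | v in T (z + B x)])).
    move=> x y _ _ [u xu <-] [v yv <-].
    rewrite -BB' -sB BB'; have := hT.1 _ _ _ _ xu yv.
    by rewrite opprD addrACA subrr add0r.
  move=> x u xu; exists (B (M u)); last by rewrite BBE invopKV.
  apply: maximally_monotone_mem => // y v yv.
  have By : B (B (M (y - z))) = y - z by rewrite BBE invopKV.
  have -> : z + B x - y = B (x - B (M (y - z))).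
    by rewrite BB' By opprB addrCA addrA.
  rewrite sB BB' BBE invopKV; apply: xu; exists v => //.
  by rewrite By addrC subrK.
exists (z + B x); rewrite opprD addrA subrr add0r -BN -e BBE invopK.
exact: Tv.
Qed.

(** Replaces the chosen value by a graph condition: [minty_metric] gives existence, and two
    solutions satisfy [<M (x1 - x2), x1 - x2> <= 0] by monotonicity. *)
Lemma resolventE z x : x = resolvent M T z <-> T x (M (z - x)).
Proof.
have [_ MD MN MB MZ] := MF.
have graph y : setinv (fun x => [set x + invop M v | v in T x]) z y <-> T y (M (z - y)).
  split; first by move=> [v yv <-]; rewrite addrC addKr invopK.
  by move=> Ty; exists (M (z - y)) => //; rewrite invopKV addrC subrK.
have uniq x1 x2 : T x1 (M (z - x1)) -> T x2 (M (z - x2)) -> x1 = x2.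
  move=> T1 T2; have := hT.1 _ _ _ _ T1 T2.
  have -> : M (z - x1) - M (z - x2) = - M (x1 - x2).
    by rewrite -MB -MN; congr M; apply: inner_inj => w; rewrite !innerE; ring.
  rewrite innerNr oppr_ge0 innerC => /calSpp_inner_le0 /eqP.
  by rewrite subr_eq0 => /eqP.
have res : T (resolvent M T z) (M (z - resolvent M T z)).
  have [y Ty] := minty_metric z; apply/graph; apply: getPex; exists y.
  exact/graph.
by split=> [->//|Tx]; exact: uniq.
Qed.

End Resolvent.
End Inverse.

(** * Finite-dimensional parametrizations *)

Section OperatorNorm.
Variables (R : realType) (E F : hilbertType R) (f : E -> F).
Hypothesis bf : bounded_op f.

Lemma opnorm_ub x : `|x| <= 1 -> `|f x| <= opnorm f.
Proof.
move=> x1; apply: ub_le_sup; last by exists x.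
have [_ [C fC]] := bf; exists `|C| => _ [y /= y1 <-]; rewrite (le_trans (fC y))//.
by rewrite (le_trans (ler_norm _))// normrM normr_id -[leRHS]mulr1 ler_wpM2l.
Qed.

Lemma opnorm_ge0 : 0 <= opnorm f.
Proof. by apply: le_trans (normr_ge0 (f 0)) (opnorm_ub _); rewrite normr0. Qed.

Lemma opnormP x : `|f x| <= opnorm f * `|x|.
Proof.
have [f0 _ _ _ fZ] := linear_facts bf.1.
have [->|x0] := eqVneq x 0; first by rewrite f0 !normr0 mulr0.
have xp : 0 < `|x| by rewrite normr_gt0.
have -> : f x = `|x| *: f (`|x|^-1 *: x) by rewrite -fZ scalerA divff ?scale1r ?gt_eqF.
rewrite normrZ normr_id mulrC ler_wpM2r// opnorm_ub//.
by rewrite normrZ ger0_norm ?invr_ge0// mulVf// gt_eqF.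
Qed.

End OperatorNorm.

Section Lincomb.
Variables (R : realType) (H : hilbertType R) (r : nat).
Implicit Types (u v : 'I_r -> H) (a b : euclid R r).

Lemma lincomb_linear u : linear (lincomb u : euclid R r -> H).
Proof.
move=> t a b; rewrite /lincomb scaler_sumr -big_split; apply: eq_bigr => i _ /=.
by rewrite !mxE scalerDl scalerA.
Qed.

Lemma lincomb_bounded u : bounded_op (lincomb u : euclid R r -> H).
Proof.
split; first exact: lincomb_linear.
exists (\sum_i `|u i|) => a; rewrite (le_trans (ler_norm_sum _ _ _))//.
rewrite mulr_suml ler_sum// => i _; rewrite normrZ mulrC ler_wpM2l//.
exact: coord_enorm.
Qed.

Lemma adjoint_lincomb u : is_adjoint (lincomb u : euclid R r -> H) (adjoint (lincomb u)).
Proof.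
suff : exists g, is_adjoint (lincomb u : euclid R r -> H) g by exact: getPex.
exists (fun y => \row_i inner (u i) y) => a y.
rewrite inner_suml; apply: eq_bigr => i _.
by rewrite innerZl mxE.
Qed.

(** The square matrix [A] expressing [u] through [v] has trivial left kernel because [u] is
    independent; its inverse expresses [v] through [u]. *)
Lemma range_lincomb_sub u v : lin_indep u ->
  (forall i, range (lincomb v) (u i)) -> range (lincomb v) `<=` range (lincomb u).
Proof.
move=> iu uv.
have /choice[f fP] : forall i, exists a : euclid R r, lincomb v a = u i.
  by move=> i; have [a _ e] := uv i; exists a.
pose A : 'M[R]_r := \matrix_i (f i : 'rV_r).
have AE (a : 'rV[R]_r) : lincomb u a = lincomb v (a *m A).
  rewrite /lincomb; under eq_bigr do rewrite -fP /lincomb scaler_sumr.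
  rewrite exchange_big; apply: eq_bigr => j _ /=.
  rewrite mxE scaler_suml; apply: eq_bigr => i _.
  by rewrite scalerA mxE.
have uA : A \in unitmx.
  rewrite -row_free_unit; apply: inj_row_free => a aA.
  apply: (iu a); rewrite AE aA /lincomb big1// => i _.
  by rewrite mxE scale0r.
by move=> _ [c _ <-]; exists (c *m invmx A) => //; rewrite AE mulmxKV.
Qed.

End Lincomb.

Section AdjointBound.
Variables (R : realType) (E F : hilbertType R) (f : E -> F) (g : F -> E).
Hypothesis fg : is_adjoint f g.

Lemma adjoint_linear : linear g.
Proof.
move=> a x y; apply: inner_inj => z.
by rewrite !(innerC _ z) -fg !innerE -!fg.
Qed.

Lemma adjoint_bounded : bounded_op f -> bounded_op g.
Proof.
move=> [_ [C fC]]; split; first exact: adjoint_linear.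
exists `|C| => y; have [->|gy] := eqVneq (g y) 0.
  by rewrite normr0 mulr_ge0.
have gp : 0 < `|g y| by rewrite normr_gt0.
rewrite -(ler_pM2l gp) -expr2 sqr_normE -fg (le_trans (inner_CauchySchwarz _ _))//.
rewrite mulrA ler_wpM2r// (le_trans (fC _))// mulrC ler_wpM2l// ler_norm//.
Qed.

End AdjointBound.

Section UQinvU.
Variables (R : realType) (H : hilbertType R) (r : nat) (Q : H -> H) (u : 'I_r -> H).
Hypotheses (lQ : linear Q) (sQ : is_adjoint Q Q).
Hypothesis hu : forall i, range Q (u i).

Local Notation U := (lincomb u : euclid R r -> H).

(** Choosing preimages of the [u i] only makes the preimage of [U a] linear and bounded in [a],
    properties that pass to [UQinvU]. *)
Lemma lincomb_preimage : exists w : 'I_r -> H, forall a, Q (lincomb w a) = U a.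
Proof.
have /choice[w wP] : forall i, exists x, Q x = u i.
  by move=> i; have [x _ e] := hu i; exists x.
exists w => a; have [Q0 QD _ _ QZ] := linear_facts lQ.
rewrite /lincomb (big_morph Q QD Q0); apply: eq_bigr => i _.
by rewrite QZ wP.
Qed.

(** The choice of [w] is immaterial: if [U b = Q v], then [<U b, w> = <v, Q w> = <v, U a>]. *)
Lemma UQinvUE a w : Q w = U a -> UQinvU Q u a = adjoint U w.
Proof.
move=> Qw; apply: get_unique; first by exists w.
move=> _ [w' Qw' <-]; apply: inner_inj => b; rewrite !(innerC _ b).
rewrite -!adjoint_lincomb; have [v <-] := lincomb_preimage.
by rewrite !sQ Qw Qw'.
Qed.

Lemma UQinvU_bounded : bounded_op (UQinvU Q u).
Proof.
have [w wP] := lincomb_preimage.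
have [lA [C AC]] := adjoint_bounded (@adjoint_lincomb _ _ _ u) (lincomb_bounded u).
have [_ [D wD]] := lincomb_bounded w.
split.
  by move=> a b c; rewrite !(UQinvUE (wP _)) lincomb_linear lA.
exists (`|C| * D) => a; rewrite (UQinvUE (wP a)) (le_trans (AC _))//.
rewrite (@le_trans _ _ (`|C| * `|lincomb w a|))// ?ler_wpM2r ?ler_norm//.
by rewrite -mulrA ler_wpM2l.
Qed.

End UQinvU.

(** * Equivalence of the resolvent equations, Lipschitz bound and strict monotonicity *)

Theorem theorem4p1 (R : realType) (H : hilbertType R) (T : H -> set H)
    (M Q V : H -> H) (r : nat) (s : R) (u : 'I_r -> H) (z : H)
    (hT : maximally_monotone T) (hM : calSpp M) (hQ : calS0 Q)
    (hr : finite_rank Q r) (hs : s = -1 \/ s = 1)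
    (hV : V = (fun x => M x + s *: Q x)) (hVpp : calSpp V)
    (hu : forall i, range Q (u i)) (hli : lin_indep u) :
  let U : euclid R r -> H := lincomb u in
  let l : euclid R r -> euclid R r := ell Q u T M s z in
  (forall xs : H,
     xs = resolvent V T z <->
     exists2 a : euclid R r, l a = 0 &
       xs = resolvent M T (z - s *: invop M (U a))) /\
  (opnorm (UQinvU Q u) + opnorm (sqrtop (invop M) \o U) ^+ 2).-lipschitz l /\
  strictly_monotone l.
Proof.
move=> U l.
have [[[lQ _] sQ] pQ0] := hQ.
have pQ x : 0 <= inner (Q x) x by have := pQ0 x; rewrite inner0l.
have [Q0 QD QN QB QZ] := linear_facts lQ.
have [M0 MD MN MB MZ] := linear_facts (calSpp_linear hM).
have [lU [D UDx]] : bounded_op U := lincomb_bounded u.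
have [U0 UD UN UB UZ] := linear_facts lU.
have UA : is_adjoint U (adjoint U) := @adjoint_lincomb _ _ _ u.
have [A0 AD AN AB AZ] := linear_facts (adjoint_linear UA).
have bUQU := UQinvU_bounded lQ sQ hu.
have [K0 KD KN KB KZ] := linear_facts bUQU.1.
have [w wP] : exists w : euclid R r -> H, forall a, Q (w a) = U a.
  by have [w wP] := lincomb_preimage lQ hu; exists (lincomb w).
have KE a : UQinvU Q u a = adjoint U (w a) by apply: UQinvUE.
have spanQ x : exists a, U a = Q x.
  have [v _ vQ] := hr; have := @range_lincomb_sub _ _ _ u v hli.
  rewrite -vQ => /(_ hu) QU; have [|a _ <-] := QU (Q x); first by exists x.
  by exists a.
pose x a := resolvent M T (z - s *: invop M (U a)).
have xT a : T (x a) (M (z - x a) - s *: U a).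
  have /(resolventE hM hT) : x a = x a by [].
  by rewrite addrAC [M (_ - _ *: _)]MB MZ invopK.
have lE a : l a = UQinvU Q u a + adjoint U (z - x a) by [].
split.
  move=> xs; rewrite (resolventE hVpp hT) hV; split.
    (* Here [xs - z] itself is a [Q]-preimage of [U a], so the two terms of [l a] cancel. *)
    move=> Txs; have [a aE] := spanQ (xs - z).
    have xsE : xs = x a.
      apply/(resolventE hM hT); rewrite addrAC [M (_ - _ *: _)]MB MZ invopK//.
      by rewrite aE -[xs - z]opprB QN scalerN opprK.
    exists a => //; rewrite lE (UQinvUE lQ sQ hu (esym aE)) -xsE -AD.
    by rewrite addrA subrK subrr.
  move=> [a la xsE]; rewrite xsE -/(x a).
  have Qz : Q (z - x a) = - U a.
    apply/eqP; rewrite -addr_eq0 -wP -QD; apply/eqP.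
    (* For [v = z - x a + w a], [Q v] is some [U b], so [<Q v, v> = <b, l a> = 0]. *)
    apply: (psd_eq0 lQ sQ pQ).
    have [b bE] := spanQ (z - x a + w a).
    by rewrite -bE UA AD addrC -KE -lE la inner0r.
  by rewrite Qz scalerN; exact: xT.
have key a b : inner (M (x a - x b)) (x a - x b)
    <= - (s * inner (x a - x b) (U (a - b))).
  have := hT.1 _ _ _ _ (xT a) (xT b).
  rewrite UB !MB !innerE (innerC _ (x a)) (innerC _ (x b)).
  rewrite !(innerC _ (x a)) !(innerC _ (x b)); lra.
split.
  have [] := sqrtop_invop hM; set B := sqrtop _ => -[[bB sB] _] BB.
  have BBE y : B (B y) = invop M y by rewrite -BB.
  have bBU : bounded_op (B \o U).
    have [lB [C BC]] := bB.
    split=> [t a b|]; first by rewrite /= lU lB.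
    exists (`|C| * D) => a /=; rewrite (le_trans (BC _))//.
    rewrite (@le_trans _ _ (`|C| * `|U a|))// ?ler_wpM2r ?ler_norm//.
    by rewrite -mulrA ler_wpM2l.
  move=> [a b] _ /=; set N := opnorm (B \o U).
  set d := a - b; set e := x a - x b.
  have lab : l a - l b = UQinvU Q u d - adjoint U e.
    by rewrite !lE KB !AB; apply: inner_inj => y; rewrite !innerE; ring.
  (* This is [M^{1/2} e]: [B f = e] and [|f|^2 = <M e, e>]. *)
  set f := B (M e).
  have Bf : B f = e by rewrite BBE invopKV.
  have eU c : inner e (U c) <= `|f| * (N * `|c|).
    rewrite -Bf sB (le_trans (inner_CauchySchwarz _ _))// ler_wpM2l//.
    exact: (opnormP bBU).
  have fN : `|f| <= N * `|d|.
    have [->|f0] := eqVneq `|f| 0.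
      exact: le_trans (opnormP bBU d).
    have fp : 0 < `|f| by rewrite lt_def f0/=.
    rewrite -(ler_pM2l fp) -expr2 sqr_normE /f sB BBE invopKV//.
    apply: (le_trans (key a b)); rewrite -/e -/d -/f.
    have [->|->] := hs; last by rewrite mul1r -innerNr -UN -(normrN d).
    by rewrite mulN1r opprK.
  rewrite lab mulrDl (le_trans (ler_normB _ _))// lerD ?opnormP//.
  (* Since [|c|^2 = <e, U c> <= |f| N |c|], the bound on [|f|] gives [|c| <= N^2 |d|]. *)
  set c := adjoint U e.
  have [->|c0] := eqVneq `|c| 0; first by rewrite mulr_ge0// sqr_ge0.
  have cp : 0 < `|c| by rewrite lt_def c0/=.
  rewrite -(ler_pM2r cp) -expr2 sqr_normE {2}/c -UA innerC (le_trans (eU c))//.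
  by rewrite mulrA ler_wpM2r// mulrC expr2 -mulrA ler_wpM2l// opnorm_ge0.
move=> a b ab.
set d := a - b; set e := x a - x b.
have d0 : 0 < inner (Q (w d)) (w d).
  rewrite lt_neqAle pQ andbT eq_sym; apply/eqP => Qw0; apply: ab.
  apply/eqP; rewrite -subr_eq0; apply/eqP/hli; rewrite -/(U (a - b)) -/d -wP.
  by apply: psd_eq0 => //; rewrite Qw0.
have lab : inner (l a - l b) d = inner (Q (w d)) (w d) - inner e (Q (w d)).
  have -> : l a - l b = adjoint U (w d - e).
    by rewrite !lE /e !AB -KE KB; apply: inner_inj => y; rewrite !innerE; ring.
  by rewrite innerC -UA -wP innerDr innerNr (innerC e).
have kab := key a b; rewrite -/e -/d -wP in kab.
rewrite {}lab; clearbody d e.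
have [s1|s1] := hs; rewrite s1 in kab; last first.
  have Me : 0 <= inner (M e) e.
    have [_ [sg sg0 /(_ e)]] := hM; apply: le_trans.
    by rewrite innerZl mulr_ge0 ?inner_ge0// ltW.
  lra.
(* Case [s = -1]: [kab], [Ve] and [Qwe] add up to a difference of at least [sg * <e, e>]. If
   [e = 0], the difference is [<Q w, w>], positive by [d0]. *)
have [_ [sg sg0 /(_ e)]] := hVpp; rewrite hV s1 !innerE => Ve.
have := pQ (w d - e); rewrite QB !innerE (sQ e (w d)) (innerC (Q (w d)) e) => Qwe.
have [e0|e0] := eqVneq e 0.
  by rewrite e0 inner0l subr0.
have ee : 0 < sg * inner e e.
  rewrite mulr_gt0// lt_neqAle inner_ge0 andbT; apply/eqP => ee.
  by move/eqP: e0; apply; apply: inner_eq0; rewrite -ee.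
lra.
Qed.
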